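(* Let $\mathcal{H}$ be a real Hilbert space, let $A, B: \mathcal{H} \rightrightarrows \mathcal{H}$ be maximally monotone operators, let $D: \mathcal{H} \to \mathcal{H}$ be an $\eta$-cocoercive operator with $\eta > 0$, and suppose that $C := \operatorname{zer} B \neq \emptyset$. Let $(\lambda_n)_{n \in \mathbb{N}}$ and $(\beta_n)_{n\in\mathbb{N}}$ be sequences of positive real numbers. Assume that: (i) $A + N_C$ is maximally monotone and $\operatorname{zer}(A + D + N_C) \neq \emptyset$; (ii) for every $p \in \operatorname{Ran} N_C$, $\displaystyle\sum_{n \in \mathbb{N}} \lambda_n \beta_n \left( \sup_{\tilde u \in C} \varphi_B\left(\tilde u, \frac{p}{\beta_n}\right) - \sigma_C\left(\frac{p}{\beta_n}\right) \right) < +\infty$; (iii) $(\lambda_n)_{n\in\mathbb{N}} \in \ell^2 \setminus \ell^1$. Let $x_0 \in \mathcal{H}$ be arbitrary and let $(x_n)_{n \geq 0}$ and $(w_n)_{n\in\mathbb{N}}$ be generated, for all $n \geq 1$, by $$y_{n-1} = x_{n-1} - \lambda_n D x_{n-1}, \qquad w_n = J_{\lambda_n A}\, y_{n-1}, \qquad x_n = J_{\lambda_n \beta_n B}\, w_n.$$ Define $\tau_n = \sum_{k=1}^n \lambda_k$ and $z_n = \frac{1}{\tau_n} \sum_{k=1}^n \lambda_k x_k$ for all $n \in \mathbb{N}$. Then $(z_n)_{n\in\mathbb{N}}$ converges weakly to an element of $\operatorname{zer}(A + D + N_C)$ as $n \to +\infty$.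
   Context: $\mathbb{N} = \{1,2,\ldots\}$. For a set-valued operator $M:\mathcal{H} \rightrightarrows \mathcal{H}$: $\operatorname{Graph} M = \{(x,u) : u \in Mx\}$, $\operatorname{Ran} M = \bigcup_{x\in\mathcal{H}} Mx$, $\operatorname{zer} M = \{x : 0 \in Mx\}$. $M$ is monotone if $\langle x-y, u-v\rangle \ge 0$ for all $(x,u),(y,v)\in\operatorname{Graph} M$, and maximally monotone if moreover its graph has no proper monotone extension in $\mathcal{H}\times\mathcal{H}$. The resolvent is $J_M = (\operatorname{Id}+M)^{-1}$, which is single-valued with full domain when $M$ is maximally monotone. A single-valued $D:\mathcal{H}\to\mathcal{H}$ is $\eta$-cocoercive if $\langle x-y, Dx-Dy\rangle \ge \eta\|Dx-Dy\|^2$ for all $x,y\in\mathcal{H}$. The normal cone is $N_C(x)=\{u : \langle u,y-x\rangle\le 0 \text{ for all } y\in C\}$ if $x\in C$ and $N_C(x)=\emptyset$ otherwise; the support function is $\sigma_C(u)=\sup_{y\in C}\langle u,y\rangle$. The Fitzpatrick function of $B$ is $\varphi_B(x,u)=\sup\{\langle x,v\rangle+\langle y,u\rangle-\langle y,v\rangle : (y,v)\in\operatorname{Graph} B\}$, with values in $\mathbb{R}\cup\{\pm\infty\}$. *)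

(* Defs.v *)
From mathcomp Require Import all_boot all_order all_algebra.
From mathcomp Require Import all_classical all_reals all_analysis.

Set Implicit Arguments.
Unset Strict Implicit.
Unset Printing Implicit Defensive.

Import Order.TTheory GRing.Theory Num.Theory.
Import numFieldNormedType.Exports.

Local Open Scope classical_set_scope.
Local Open Scope ring_scope.

(* A set-valued operator M : H =>> H is a function M : H -> set H. *)
Section SetValuedOperators.
Context {R : realType} {H : lmodType R}.
Implicit Types (M N : H -> set H) (D : H -> H).

Definition graph M : set (H * H) := [set xu | M xu.1 xu.2].

Definition ran M : set H := \bigcup_x M x.

Definition zer M : set H := [set x | M x 0].

Definition op_of_fun D : H -> set H := fun x => [set D x].

Definition op_add M N : H -> set H :=
  fun x => [set u + v | u in M x & v in N x].

Definition op_scale (a : R) M : H -> set H := fun x => [set a *: u | u in M x].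

Definition op_inv M : H -> set H := fun u => [set x | M x u].

(* J_M = (Id + M)^-1 is kept set-valued: w = J_M y reads resolvent M y w. *)
Definition resolvent M : H -> set H := op_inv (op_add (op_of_fun id) M).

End SetValuedOperators.

(* The inner product is a dot product form of the sesquilinear library; a real
   Hilbert space is a complete normed module H together with such a form dot
   that induces its norm. *)
Section HilbertSpace.
Context {R : realType} {H : completeNormedModType R}.
Variable dot : {dot H for idfun}.
Implicit Types (M : H -> set H) (C : set H).

Definition induces_norm : Prop := forall x : H, `|x| = Num.sqrt (dot x x).

Definition monotone_op M : Prop :=
  forall x u y v, graph M (x, u) -> graph M (y, v) -> 0 <= dot (x - y) (u - v).

Definition maximally_monotone M : Prop :=
  monotone_op M /\
  forall N : H -> set H, monotone_op N -> graph M `<=` graph N ->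
    graph N = graph M.

Definition cocoercive (eta : R) (D : H -> H) : Prop :=
  forall x y, eta * `|D x - D y| ^+ 2 <= dot (x - y) (D x - D y).

Definition normal_cone C : H -> set H :=
  fun x => [set u | C x /\ forall y, C y -> dot u (y - x) <= 0].

Definition support_fun C (u : H) : \bar R :=
  ereal_sup [set (dot u y)%:E | y in C].

Definition fitzpatrick M (x u : H) : \bar R :=
  ereal_sup [set (dot x yv.2 + dot yv.1 u - dot yv.1 yv.2)%:E | yv in graph M].

Definition weakly_cvg (z : nat -> H) (l : H) : Prop :=
  forall u : H, dot (z n) u @[n --> \oo] --> dot l u.

End HilbertSpace.

(* Membership in l^p of a sequence indexed by 1, 2, ...: the value at 0 is
   ignored. *)
Definition in_ell {R : realType} (p : nat) (a : nat -> R) : Prop :=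
  (\sum_(1 <= n <oo) (`|a n| ^+ p)%:E < +oo)%E.

(* Main.v *)
Require Import Defs.
From mathcomp Require Import all_boot all_order all_algebra.
From mathcomp Require Import lra.
From mathcomp Require Import all_classical all_reals all_analysis.

Import Order.TTheory GRing.Theory Num.Theory.
Import numFieldNormedType.Exports.

Local Open Scope classical_set_scope.
Local Open Scope ring_scope.

(** Write [T = A + D + N_C] and let [v = a + D u + p] be an element of [T u],
    with [a \in A u] and [p \in N_C u].  Monotonicity of [A] at [(w_n, u)], the
    definition of the Fitzpatrick function of [B] at [(x_n, u)] and
    cocoercivity of [D] add up, as soon as [lambda_n <= 2 eta], to the descent
    inequality (lemma [forward_backward_penalty_step])

      [|x_n - u|^2 + 2 lambda_n <x_n - u, v> <= |x_(n-1) - u|^2 + e_n],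

    where [e_n] is [2 lambda_n beta_n] times the gap between the supremum of the
    Fitzpatrick function and the support function at [p / beta_n], plus
    [lambda_n^2 |a + D u|^2].  The gap is nonnegative, and the [e_n] are
    summable because the weighted gaps and the [lambda_n^2] are.  Two things
    follow.

    - For [u \in zer T], take [v = 0]: the sequence [|x_n - u|^2] is
      quasi-Fejer, hence convergent ([quasi_fejer_is_cvg]).
    - Summing for a general [(u, v)], [2 tau_n <z_n - u, v>] is bounded above
      while [tau_n] tends to infinity; so every weak cluster point [l] of [z]
      satisfies [<l - u, v> <= 0] for all [(u, v)] in the graph of [T].  As
      [A + N_C] is maximally monotone and [D] is Lipschitz and monotone, this
      forces [l \in zer T] ([add_cocoercive_unextendable]).

    The ergodic form of Opial's lemma ([ergodic_opial]) turns these two facts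
    into weak convergence: if [l] and [l'] are two cluster points, the
    convergence of both [|x_n - l|^2] and [|x_n - l'|^2] makes
    [<x_n, l - l'>], hence its weighted mean [<z_n, l - l'>], converge, so that
    [<l, l - l'> = <l', l - l'>].

    Cluster points are taken along ultrafilters finer than [\oo]: bounded real
    functions converge along them, and Riesz representation provides the weak
    limit.  Both this representation and the surjectivity of
    [Id + t M] for a maximally monotone [M] (Minty's theorem, used for the
    maximality of [A + D + N_C]) are instances of one minimisation result,
    [exists_strongly_convex_minimizer]. *)

(** * Real inner products *)

Section Dot.
Context {R : realType} {H : completeNormedModType R}.
Variable dot : {dot H for idfun}.
Hypothesis dot_norm : induces_norm dot.
Implicit Types (a b u v x y : H).

Lemma dotC x y : dot x y = dot y x.
Proof. by rewrite [LHS]hermC expr0 mul1r. Qed.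

Lemma dotZl t x y : dot (t *: x) y = t * dot x y.
Proof. exact: linearZl_LR. Qed.

Lemma dotZr t x y : dot x (t *: y) = t * dot x y.
Proof. by rewrite dotC dotZl dotC. Qed.

Lemma dotDl x y z : dot (x + y) z = dot x z + dot y z.
Proof. exact: linearDl. Qed.

Lemma dotDr x y z : dot z (x + y) = dot z x + dot z y.
Proof. exact: linearDr. Qed.

Lemma dotNl x y : dot (- x) y = - dot x y.
Proof. exact: linearNl. Qed.

Lemma dotNr x y : dot x (- y) = - dot x y.
Proof. exact: linearNr. Qed.

Lemma dot0l x : dot 0 x = 0.
Proof. exact: linear0l. Qed.

Lemma dot0r x : dot x 0 = 0.
Proof. exact: linear0r. Qed.

Definition dotE := (dotDl, dotDr, dotNl, dotNr, dotZl, dotZr, dot0l, dot0r).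

Lemma dotxx_ge0 x : 0 <= dot x x.
Proof.
have [->|x0] := eqVneq x 0; first by rewrite dotE.
exact/ltW/neq0_dnorm_gt0.
Qed.

Lemma dotxx_eq0 x : dot x x = 0 -> x = 0.
Proof. by apply: contraPP => /eqP /(@neq0_dnorm_gt0 _ _ _ dot) /gt_eqF/eqP. Qed.

Lemma sqr_norm x : `|x| ^+ 2 = dot x x.
Proof. by rewrite dot_norm sqr_sqrtr ?dotxx_ge0. Qed.

(** Expand [0 <= |s|^2] for [s = |x|^2 y - <x, y> x], which is [|x|^2] times
    the component of [y] orthogonal to [x]. *)
Lemma cauchy_schwarz x y : `|dot x y| <= `|x| * `|y|.
Proof.
have [->|x0] := eqVneq x 0; first by rewrite dotE !normr0 mul0r.
rewrite -(@ler_sqr _ _ _) ?nnegrE ?mulr_ge0// exprMn !sqr_norm.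
rewrite real_normK ?num_real//.
have xx0 := @neq0_dnorm_gt0 _ _ _ dot _ x0.
have := dotxx_ge0 (dot x x *: y - dot x y *: x).
rewrite !dotE (dotC y x) => h.
rewrite -(ler_pM2l xx0).
move: h; set p := dot x x; set q := dot y y; set s := dot x y. lra.
Qed.

Lemma polarization x y :
  dot x y = (`|x + y| ^+ 2 - `|x - y| ^+ 2) / 4.
Proof. by rewrite !sqr_norm !dotE (dotC y x); lra. Qed.

(** By polarization, joint continuity reduces to that of the norm. *)
Lemma cvg_dot {T : Type} (F : set_system T) {FF : Filter F} (f g : T -> H) a b :
  f t @[t --> F] --> a -> g t @[t --> F] --> b ->
  dot (f t) (g t) @[t --> F] --> dot a b.
Proof.
move=> fa gb; rewrite polarization.
under eq_fun do rewrite polarization.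
apply: cvgMr_tmp; apply: cvgB.
  rewrite !expr2; under eq_fun do rewrite expr2.
  by apply: cvgM; apply: cvg_norm; apply: cvgD.
rewrite !expr2; under eq_fun do rewrite expr2.
by apply: cvgM; apply: cvg_norm; apply: cvgB.
Qed.

(** * Minimisation of strongly convex functions *)

Lemma cvgn_of_dist_le (f : nat -> H) (e : nat -> R) :
  e @ \oo --> 0 ->
  (forall i j, dot (f i - f j) (f i - f j) <= e i + e j) -> cvgn f.
Proof.
move=> e0 fe; apply/cauchy_cvgP/cauchyP => d d0.
have d20 : 0 < d ^+ 2 / 2 by rewrite divr_gt0 ?exprn_gt0.
have [N _ NE] := (cvgr_lt _ e0 _ d20).
exists (f N); change (\forall n \near \oo, ball (f N) d (f n)); near=> n.
rewrite -ball_normE /=.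
rewrite -(@ltr_sqr _ _ _) ?nnegrE ?(ltW d0)// sqr_norm.
apply: le_lt_trans (fe _ _) _.
have := NE N (leqnn N); have : (N <= n)%N by near: n; exists N.
by move=> /NE/=; lra.
Unshelve. all: by end_near. Qed.

(** First-order optimality: the right derivative [a] at a minimum is
    nonnegative. *)
Lemma ge0_of_small_quadratic (a b : R) :
  (forall t, 0 < t -> t <= 1 -> 0 <= t * a + t ^+ 2 * b) -> 0 <= a.
Proof.
move=> h; rewrite leNgt; apply/negP => a0.
have b1 : 0 < `|b| + 1 by rewrite ltr_wpDl.
pose t := Num.min 1 (- a / (2 * (`|b| + 1))).
have t0 : 0 < t by rewrite lt_min ltr01 divr_gt0 ?mulr_gt0 ?oppr_gt0.
have t1 : t <= 1 by rewrite ge_min lexx.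
have t2 : t * (2 * (`|b| + 1)) <= - a.
  by rewrite -ler_pdivlMr ?mulr_gt0// ge_min lexx orbT.
have := h t t0 t1; rewrite expr2 -mulrA -mulrDr pmulr_rge0// => abt.
have : t * b <= t * `|b| by rewrite ler_pM2l// ler_norm.
by lra.
Qed.

(** The objective [r + |(x, u)|^2 / 2] is strongly convex in [(x, u)] on the
    convex set [E], so the parallelogram identity makes every minimising
    sequence Cauchy, and the limit stays in the closed set [E].  When [E] is
    the epigraph of a convex function [f], the conclusion is the optimality
    condition that [- (x, u)] is a subgradient of [f] at [(x, u)]; sets
    instead of functions avoid infinite values. *)
Lemma exists_strongly_convex_minimizer (E : H -> H -> R -> Prop) (c : R) :
  (exists x u r, E x u r) ->
  (forall x u r, E x u r -> c <= r + (dot x x + dot u u) / 2) ->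
  (forall t x u r y v s, 0 <= t <= 1 -> E x u r -> E y v s ->
     E (x + t *: (y - x)) (u + t *: (v - u)) (r + t * (s - r))) ->
  (forall (xs us : nat -> H) (rs : nat -> R) x u r,
     (forall n, E (xs n) (us n) (rs n)) ->
     xs @ \oo --> x -> us @ \oo --> u -> rs @ \oo --> r -> E x u r) ->
  exists x u r, E x u r /\
    forall y v s, E y v s -> r <= s + dot x (y - x) + dot u (v - u).
Proof.
move=> [x1 [u1 [r1 E1]]] Ec Econv Ecl.
pose V x u r : R := r + (dot x x + dot u u) / 2.
pose S : set R := [set q | exists x u r, E x u r /\ q = V x u r].
have Slb : has_lbound S by exists c => _ [x [u [r [Exur ->]]]]; exact: Ec.
have Sinf : has_inf S by split=> //; exists (V x1 u1 r1), x1, u1, r1.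
pose m := inf S.
have Vm x u r : E x u r -> m <= V x u r.
  by move=> Exur; apply: ge_inf => //; exists x, u, r.
have /choice[X hX] : forall n : nat, exists q : H * H * R,
    E q.1.1 q.1.2 q.2 /\ V q.1.1 q.1.2 q.2 <= m + n.+1%:R^-1.
  move=> n; have n0 : 0 < n.+1%:R^-1 :> R by rewrite invr_gt0.
  have [_ [x [u [r [Exur ->]]]] /ltW Vlt] := inf_adherent n0 Sinf.
  by exists ((x, u), r).
have close i j : dot ((X i).1.1 - (X j).1.1) ((X i).1.1 - (X j).1.1)
    + dot ((X i).1.2 - (X j).1.2) ((X i).1.2 - (X j).1.2)
    <= 4 * i.+1%:R^-1 + 4 * j.+1%:R^-1.
  have [[Ei Vi] [Ej Vj]] := (hX i, hX j).
  (* The value at the midpoint is at least [m]: strong convexity bounds the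
     distance of the two points by their excess over [m]. *)
  have half : 0 <= (1 / 2 : R) <= 1 by lra.
  have := Vm _ _ _ (Econv _ _ _ _ _ _ _ half Ei Ej).
  move: Vi Vj; rewrite /V !dotE.
  move: (X i) (X j) => [[x u] r] [[y v] s] /=.
  rewrite (dotC y x) (dotC v u).
  move: (i.+1%:R^-1) (j.+1%:R^-1) => a b; lra.
have e0 : 4 * n.+1%:R^-1 @[n --> \oo] --> (0 : R).
  by rewrite -(mulr0 4); apply: cvgMl_tmp; exact: cvg_harmonic.
have /cvg_ex[x0 Xx] : cvgn (fun n => (X n).1.1).
  apply: (cvgn_of_dist_le _ _ e0) => i j; apply: le_trans (close i j).
  by rewrite lerDl dotxx_ge0.
have /cvg_ex[u0 Xu] : cvgn (fun n => (X n).1.2).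
  apply: (cvgn_of_dist_le _ _ e0) => i j; apply: le_trans (close i j).
  by rewrite lerDr dotxx_ge0.
pose r0 := m - (dot x0 x0 + dot u0 u0) / 2.
have Xr : (X n).2 @[n --> \oo] --> r0.
  have VX : V (X n).1.1 (X n).1.2 (X n).2 @[n --> \oo] --> m.
    apply: (@squeeze_cvgr _ _ _ _ (fun=> m) (fun n => m + n.+1%:R^-1)).
    - by near=> n; have [En Vn] := hX n; rewrite Vm.
    - exact: cvg_cst.
    - rewrite -[X in _ --> X]addr0; apply: cvgD; first exact: cvg_cst.
      exact: cvg_harmonic.
  have -> : (fun n => (X n).2) = (fun n => V (X n).1.1 (X n).1.2 (X n).2
       - (dot (X n).1.1 (X n).1.1 + dot (X n).1.2 (X n).1.2) / 2).
    by apply/funext => n; rewrite /V addrK.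
  by apply: cvgB => //; apply: cvgMr_tmp; apply: cvgD; apply: cvg_dot.
have E0 : E x0 u0 r0.
  by apply: (Ecl _ _ _ _ _ _ _ Xx Xu Xr) => n; have [] := hX n.
exists x0, u0, r0; split=> // y v s Ey.
rewrite -subr_ge0.
apply: (@ge0_of_small_quadratic (s + dot x0 (y - x0) + dot u0 (v - u0) - r0)
   ((dot (y - x0) (y - x0) + dot (v - u0) (v - u0)) / 2)) => t t0 t1.
have t01 : 0 <= t <= 1 by rewrite ltW.
have := Vm _ _ _ (Econv _ _ _ _ _ _ _ t01 E0 Ey).
rewrite /V /r0 !dotE (dotC y x0) (dotC v u0).
by lra.
Unshelve. all: by end_near. Qed.

End Dot.

(** * Maximally monotone operators *)

Section Monotone.
Context {R : realType} {H : completeNormedModType R}.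
Variable dot : {dot H for idfun}.
Hypothesis dot_norm : induces_norm dot.
Implicit Types (M : H -> set H) (a b u v x y : H).

Local Notation dotE := (dotE dot).
Local Notation dotC := (dotC dot).

(** The pointwise form of maximality: unlike the inclusion of graphs, it is
    stable under changes of variables in the operator. *)
Definition unextendable M :=
  forall x u, (forall y v, M y v -> 0 <= dot (x - y) (u - v)) -> M x u.

Lemma maximally_monotone_unextendable M :
  maximally_monotone dot M -> unextendable M.
Proof.
move=> [Mmono Mmax] x u xuM.
pose N : H -> set H := fun y => [set v | M y v \/ (y = x /\ v = u)].
have Nmono : monotone_op dot N.
  move=> y v y' v' [Myv|[/= -> ->]] [Myv'|[/= -> ->]].
  - exact: Mmono Myv Myv'.
  - by have := xuM _ _ Myv; rewrite !dotE; lra.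
  - exact: xuM.
  - by rewrite !dotE; lra.
have MN : graph M `<=` graph N by move=> [y v] Myv; left.
have : graph N (x, u) by right.
by rewrite (Mmax N Nmono MN).
Qed.

(** Minty's theorem at [0].  Let [f] be the Fitzpatrick function of [M], whose
    epigraph is [E]; maximality gives [f(x, u) >= <x, u>], hence
    [f + |.|^2 / 2 >= |x + u|^2 / 2 >= 0] and a minimiser [(x, u)] exists.  On
    the graph of [M], [f(y, v) = <y, v>], so the optimality condition reads
    [<y + u, v + x> >= |x + u|^2]: hence [(- u, - x)] belongs to the graph
    of [M], and the same inequality at this point yields [x + u = 0]. *)
Lemma zero_in_ran_id_add M : monotone_op dot M -> unextendable M ->
  exists x, M x (- x).
Proof.
move=> Mmono Mmax.
have [y0 [v0 M0]] : exists y v, M y v.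
  apply: contrapT => M0; apply: (M0); exists 0, 0; apply: Mmax => y v Myv.
  by exfalso; apply: M0; exists y, v.
pose E x u (r : R) :=
  forall y v, M y v -> dot x v + dot y u - dot y v <= r.
have EM y v : M y v -> E y v (dot y v).
  move=> Myv y' v' Myv'; have := Mmono _ _ _ _ Myv Myv'.
  by rewrite !dotE; lra.
have Edot x u r : E x u r -> dot x u <= r.
  move=> Exur; have [/Exur|nM] := pselect (M x u); first by lra.
  rewrite leNgt; apply/negP => rxu; apply: nM; apply: Mmax => y v /Exur.
  by rewrite !dotE; lra.
have [||||x [u [r [Exur xur]]]] :=
  exists_strongly_convex_minimizer dot dot_norm E 0.
- by exists y0, v0, (dot y0 v0); exact: EM.
- move=> x u r /Edot; have := dotxx_ge0 dot (x + u).
  by rewrite !dotE (dotC u x); lra.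
- move=> t x u r y v s /andP[t0 t1] Ex Ey y' v' M'.
  have := ler_wpM2l t0 (Ey _ _ M').
  have t1' : 0 <= 1 - t by rewrite subr_ge0.
  have := ler_wpM2l t1' (Ex _ _ M').
  by rewrite !dotE; lra.
- move=> xs us rs x u r En xsx usu rsr y v Myv.
  have lhs : dot (xs n) v + dot y (us n) - dot y v @[n --> \oo] -->
      dot x v + dot y u - dot y v.
    apply: cvgB; last exact: cvg_cst.
    by apply: cvgD; apply: cvg_dot => //; exact: cvg_cst.
  apply: (ler_cvg_to lhs rsr).
  by near=> n; exact: En.
have Mux : M (- u) (- x).
  apply: Mmax => y v Myv.
  have := xur _ _ _ (EM _ _ Myv); have := Edot _ _ _ Exur.
  have := dotxx_ge0 dot (x + u).
  by rewrite !dotE (dotC u x) (dotC u v) (dotC y x); lra.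
suff ux : - u = x by exists x; rewrite -{1}ux.
apply/eqP; rewrite -subr_eq0 -oppr_eq0 opprB opprK; apply/eqP.
apply: (dotxx_eq0 dot); apply/eqP; rewrite eq_le dotxx_ge0 andbT.
have := xur _ _ _ (EM _ _ Mux); have := Edot _ _ _ Exur.
by rewrite !dotE (dotC u x); lra.
Unshelve. all: by end_near. Qed.

(** Apply the previous lemma to [x |-> t M x - y]. *)
Lemma resolvent_total M (t : R) y : 0 < t -> maximally_monotone dot M ->
  exists x, M x (t^-1 *: (y - x)).
Proof.
move=> t0 MM; have [Mmono _] := MM.
have Mmax := maximally_monotone_unextendable _ MM.
have ti : 0 < t^-1 by rewrite invr_gt0.
pose M' : H -> set H := fun x => [set v | M x (t^-1 *: (y + v))].
suff [x] : exists x, M' x (- x) by exists x.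
apply: zero_in_ran_id_add.
  move=> x u x' u' Mx Mx'.
  have := Mmono x (t^-1 *: (y + u)) x' (t^-1 *: (y + u')) Mx Mx'.
  by rewrite -scalerBr dotZr pmulr_rge0// [y + u]addrC addrKA.
move=> x u xuM; apply: Mmax => x' v' Mx'.
have /xuM : M' x' (t *: v' - y).
  by rewrite /M'/= addrC subrK scalerA mulVf ?gt_eqF// scale1r.
rewrite -(pmulr_rge0 _ ti) -dotZr.
by rewrite opprB addrA [u + y]addrC scalerBr scalerA mulVf ?gt_eqF// scale1r.
Qed.

(** The sum of a maximally monotone and a cocoercive operator is maximal, at a
    zero.  Let [u] be the resolvent of [t M] at [x - t D x], so that
    [u = x] is exactly the conclusion.  Testing the hypothesis at [u] gives
    [|u - x|^2 <= t <u - x, D u - D x>]; since [D] is [1 / eta]-Lipschitz, the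
    choice [t = eta / 2] gives [|u - x|^2 <= |u - x|^2 / 2]. *)
Lemma add_cocoercive_unextendable M D eta x : 0 < eta ->
  maximally_monotone dot M -> cocoercive dot eta D ->
  (forall y v, M y v -> 0 <= dot (y - x) (v + D y)) -> M x (- D x).
Proof.
move=> eta0 MM Dco xM.
have t0 : 0 < eta / 2 by rewrite divr_gt0.
have [u Mu] := resolvent_total M (eta / 2) (x - (eta / 2) *: D x) t0 MM.
have ux : u = x.
  apply/eqP; rewrite -subr_eq0; apply/eqP; apply: (dotxx_eq0 dot).
  apply/eqP; rewrite eq_le dotxx_ge0 andbT.
  have := xM _ _ Mu; have := Dco u x; rewrite (sqr_norm dot)//.
  have -> : (eta / 2)^-1 *: (x - (eta / 2) *: D x - u) + D u =
            (D u - D x) - (eta / 2)^-1 *: (u - x).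
    rewrite !scalerBr scalerA mulVf ?gt_eqF// scale1r.
    by rewrite opprB addrC [_ - _ - _ *: u]addrAC addrA [LHS]addrAC.
  have := dotxx_ge0 dot (eta *: (D u - D x) - (u - x)).
  move: (u - x) (D u - D x) => p q h0 h1 h2.
  have h3 : 0 <= eta / 2 * dot p q - dot p p.
    have := mulr_ge0 (ltW t0) h2; rewrite dotDr dotNr dotZr mulrBr.
    by rewrite (mulrA (eta / 2) _^-1) divff ?gt_eqF// mul1r.
  have := ler_wpM2l (ltW eta0) h1; move: h0 h3.
  by rewrite !dotE (dotC q p); lra.
move: Mu; rewrite ux addrAC subrr sub0r scalerN scalerA mulVf ?gt_eqF//.
by rewrite scale1r.
Qed.

End Monotone.

(** * Weak limits along ultrafilters *)

Section WeakCompactness.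
Context {R : realType} {H : completeNormedModType R}.
Variable dot : {dot H for idfun}.
Hypothesis dot_norm : induces_norm dot.

Local Notation dotE := (dotE dot).

(** A set that is not in [F] is avoided by some ultrafilter finer than [F]. *)
Lemma cvg_of_ultra {T : Type} {V : topologicalType} (F : set_system T)
    {FF : Filter F} (f : T -> V) (l : V) :
  (forall U, UltraFilter U -> F `<=` U -> f t @[t --> U] --> l) ->
  f t @[t --> F] --> l.
Proof.
move=> Ul A Al; apply: contrapT => nFA.
pose G := within (~` (f @^-1` A)) F.
have GP : ProperFilter G.
  split; last exact: within_filter.
  move=> G0; apply: nFA.
  have {}G0 : F [set t | (~` (f @^-1` A)) t -> set0 t] := G0.
  apply: (@filterS T F FF _ (f @^-1` A) _ G0) => t nA.
  by apply: contrapT => nAt; exact: (nA nAt).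
have [U [UU GU]] := ultraFilterLemma GP.
have FU : F `<=` U.
  by apply: subset_trans GU; exact: cvg_within.
have UA : U (f @^-1` A) := Ul U UU FU A Al.
have UnA : U (~` (f @^-1` A)).
  by apply: GU; exact: (@filterS T F FF setT _ (fun t _ nAt => nAt) filterT).
by have [t []] := filter_ex (filterI UA UnA).
Qed.

Lemma bounded_ultra_cvg {T : Type} (U : set_system T) {UU : UltraFilter U}
    (f : T -> R) (K : R) :
  (\forall t \near U, `|f t| <= K) -> exists l : R, f t @[t --> U] --> l.
Proof.
move=> fK.
have fU : UltraFilter (f @ U).
  split; first exact: fmap_proper_filter.
  move=> G GG fG; apply/seteqP; split=> // S GS.
  have [//|UnS] := in_ultra_setVsetC (f @^-1` S) UU.
  have /fG GnS : (f @ U) (~` S) by [].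
  by have [r []] := filter_ex (filterI GS GnS).
have := @segment_compact R (- K) K; rewrite compact_ultra => /(_ _ fU).
case; last by move=> l [_ fl]; exists l.
by apply: filterS fK => t; rewrite /= in_itv/= ler_norml.
Qed.

(** The representing vector minimises [|x|^2 / 2 - L x], and the optimality
    condition is the representation.  The second factor of [H * H] is held
    at [0]. *)
Lemma riesz (L : H -> R) (K : R) :
  (forall t x y, L (t *: x + y) = t * L x + L y) ->
  (forall x, `|L x| <= K * `|x|) -> exists a, forall x, L x = dot a x.
Proof.
move=> Llin LK.
have L0 : L 0 = 0.
  by apply/eqP; rewrite -normr_le0 (le_trans (LK 0))// normr0 mulr0.
have LN x : L (- x) = - L x by rewrite -[- x]addr0 -scaleN1r Llin L0; lra.
have LB x y : L (x - y) = L x - L y by rewrite addrC -scaleN1r Llin; lra.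
have Lcvg (f : nat -> H) x : f @ \oo --> x -> L (f n) @[n --> \oo] --> L x.
  move=> fx; apply/cvgrPdist_lt => e e0.
  have K0 : 0 < `|K| + 1 by rewrite ltr_wpDl.
  move/cvgrPdist_lt : fx => /(_ _ (divr_gt0 e0 K0)).
  apply: filterS => n; rewrite ltr_pdivlMr// mulrC => h.
  rewrite -LB; apply: le_lt_trans (LK _) _; apply: le_lt_trans _ h.
  by rewrite ler_wpM2r// (le_trans (ler_norm _))// lerDl.
pose E x u r := u = 0 :> H /\ r = - L x.
have [||||a [u [r [[u0 ->] aur]]]] :=
  exists_strongly_convex_minimizer dot dot_norm E (- K ^+ 2 / 2).
- by exists 0, 0, (- L 0).
- move=> x u r [-> ->]; rewrite dot0l -(sqr_norm dot)//.
  have := sqr_ge0 (K - `|x|); have := ler_norm (L x); have := LK x.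
  by rewrite sqrrB; lra.
- move=> t x u r y v s _ [-> ->] [-> ->]; split.
    by rewrite subrr scaler0 addr0.
  by rewrite [x + _]addrC Llin LB; lra.
- move=> xs us rs x u r En xsx usu rsr; split.
    apply: (@norm_cvg_unique _ _ _ _ _ _ usu).
    have -> : us = fun=> 0 by apply/funext => n; have [] := En n.
    exact: cvg_cst.
  apply: (@norm_cvg_unique _ _ _ _ _ _ rsr).
  have -> : rs = fun n => - L (xs n) by apply/funext => n; have [] := En n.
  by apply: cvgN; exact: Lcvg.
have key h : L h <= dot a h.
  have := aur (a + h) 0 (- L (a + h)) (conj erefl erefl).
  rewrite u0 dot0l addr0 [a + h]addrC addrK.
  by rewrite -{1}[h]scale1r Llin; lra.
exists a => h; apply/eqP; rewrite eq_le key /=.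
by have := key (- h); rewrite LN dotNr; lra.
Qed.

(** Weak compactness of balls: the limits of the inner products with a fixed
    vector form a bounded linear functional. *)
Lemma bounded_ultra_weak_cvg {T : Type} (U : set_system T)
    {UU : UltraFilter U} (z : T -> H) (K : R) :
  (\forall t \near U, `|z t| <= K) ->
  exists l, forall h, dot (z t) h @[t --> U] --> dot l h.
Proof.
move=> zK.
have hK h : \forall t \near U, `|dot (z t) h| <= K * `|h|.
  apply: filterS zK => t zt; apply: le_trans (cauchy_schwarz _ _ _ _) _ => //.
  by rewrite ler_wpM2r.
have /choice[L hL] : forall h, exists l : R, dot (z t) h @[t --> U] --> l.
  by move=> h; exact: bounded_ultra_cvg (hK h).
have [||l hl] := riesz L K.
- move=> t x y; apply: (@norm_cvg_unique _ _ _ _ _ _ (hL _)).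
  have -> : (fun s => dot (z s) (t *: x + y)) =
            (fun s => t * dot (z s) x + dot (z s) y).
    by apply/funext => s; rewrite !dotE.
  by apply: cvgD => //; exact: cvgMl_tmp.
- by move=> h; exact: cvgr_to_le (cvg_norm (hL h)) (hK h).
by exists l => h; rewrite -hl.
Qed.

End WeakCompactness.

(** * Real sequences *)

Section RealSequences.
Context {R : realType}.
Implicit Types (lambda a s d e : nat -> R).

(** The Toeplitz lemma: the terms before the rank [N] where [a] comes
    [e / 2]-close to [l] contribute a constant [K], which the total weight
    absorbs. *)
Lemma cvg_weighted_mean lambda a (l : R) :
  (forall n, (1 <= n)%N -> 0 < lambda n) ->
  \sum_(1 <= k < n.+1) lambda k @[n --> \oo] --> +oo ->
  a n @[n --> \oo] --> l ->
  (\sum_(1 <= k < n.+1) lambda k)^-1 * \sum_(1 <= k < n.+1) lambda k * a k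
    @[n --> \oo] --> l.
Proof.
move=> lam0 tauoo /cvgrPdist_lt al; apply/cvgrPdist_le => e e0.
have e20 : 0 < e / 2 by rewrite divr_gt0.
have [N _ aN] := al _ e20.
pose dev k := lambda k * `|l - a k|.
have dev0 k : (1 <= k)%N -> 0 <= dev k.
  by move=> /lam0 l0; rewrite mulr_ge0// ltW.
pose K := \sum_(1 <= k < N.+1) dev k.
have tau_gt := (cvgryPgt _).1 tauoo.
near=> n.
have Nn : (N <= n)%N by near: n; exists N.
have tau0 : 0 < \sum_(1 <= k < n.+1) lambda k by near: n; exact: tau_gt.
have tauK : 2 / e * K < \sum_(1 <= k < n.+1) lambda k.
  by near: n; exact: tau_gt.
set tau := \sum_(1 <= k < n.+1) lambda k in tau0 tauK *.
have Ktau : K <= e / 2 * tau.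
  move: tauK; rewrite -(ltr_pM2l e20) mulrA -(invf_div e 2) divff ?gt_eqF//.
  by rewrite mul1r => /ltW.
rewrite -(ler_pM2l tau0) -{1}(gtr0_norm tau0) -normrM mulrBr.
rewrite mulrA divff ?gt_eqF// mul1r mulr_suml -sumrB.
under eq_bigr do rewrite -mulrBr.
apply: le_trans (ler_norm_sum _ _ _) _.
have -> : \sum_(1 <= k < n.+1) `|lambda k * (l - a k)| =
          \sum_(1 <= k < n.+1) dev k.
  by apply: eq_big_nat => k /andP[k1 _]; rewrite normrM gtr0_norm ?lam0.
rewrite (big_cat_nat (n := N.+1))//= -/K.
have : \sum_(N.+1 <= k < n.+1) dev k <= e / 2 * tau.
  apply: (@le_trans _ _ (\sum_(N.+1 <= k < n.+1) lambda k * (e / 2))).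
    apply: ler_sum_nat => k /andP[Nk _]; rewrite ler_pM2l ?lam0//; last first.
      exact: leq_trans Nk.
    by apply/ltW/aN => /=; exact: ltnW.
  rewrite -mulr_suml mulrC ler_pM2l// /tau.
  rewrite [leRHS](big_cat_nat (n := N.+1))//= lerDr big_nat_cond sumr_ge0//.
  by move=> k /andP[/andP[k1 _] _]; rewrite ltW ?lam0.
by lra.
Unshelve. all: by end_near. Qed.

(** [s n + \sum d - \sum e] is nonincreasing from [N] on. *)
Lemma sum_decrements_bounded s d e (K : R) (N : nat) :
  (forall n, 0 <= s n) ->
  (forall n, \sum_(1 <= k < n.+1) e k <= K) ->
  (forall n, (N <= n)%N -> s n.+1 + d n.+1 <= s n + e n.+1) ->
  exists K', forall n, (N <= n)%N -> \sum_(1 <= k < n.+1) d k <= K'.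
Proof.
move=> s0 eK se.
exists (s N + \sum_(1 <= k < N.+1) d k - \sum_(1 <= k < N.+1) e k + K) => n Nn.
suff : s n + \sum_(1 <= k < n.+1) d k - \sum_(1 <= k < n.+1) e k <=
       s N + \sum_(1 <= k < N.+1) d k - \sum_(1 <= k < N.+1) e k.
  by have := s0 n; have := eK n; lra.
elim: n Nn => [|n IH]; first by rewrite leqn0 => /eqP ->.
rewrite leq_eqVlt => /predU1P[<-//|]; rewrite ltnS => Nn.
rewrite [in X in X <= _]big_nat_recr//= [X in _ - X <= _]big_nat_recr//=.
by have := IH Nn; have := se n Nn; lra.
Qed.

Lemma bounded_nneg_sum_is_cvg e (K : R) :
  (forall n, (1 <= n)%N -> 0 <= e n) ->
  (forall n, \sum_(1 <= k < n.+1) e k <= K) ->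
  cvgn (fun n => \sum_(1 <= k < n.+1) e k).
Proof.
move=> e0 eK; apply: nondecreasing_is_cvgn.
  by apply/nondecreasing_seqP => n; rewrite [leRHS]big_nat_recr//= lerDl e0.
by exists K => _ [n _ <-].
Qed.

(** [s - \sum e] is nonincreasing from [N] on and bounded below, and [\sum e]
    converges. *)
Lemma quasi_fejer_is_cvg s e (K : R) (N : nat) :
  (forall n, 0 <= s n) -> (forall n, (1 <= n)%N -> 0 <= e n) ->
  (forall n, \sum_(1 <= k < n.+1) e k <= K) ->
  (forall n, (N <= n)%N -> s n.+1 <= s n + e n.+1) -> cvgn s.
Proof.
move=> s0 e0 eK se.
pose E n := \sum_(1 <= k < n.+1) e k.
have cE : cvgn E by exact: bounded_nneg_sum_is_cvg eK.
have csE : cvgn (fun n => s n - E n).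
  apply/cvg_ex; have /cvg_ex[l cl] : cvgn (fun n => s (n + N)%N - E (n + N)%N).
    apply: nonincreasing_is_cvgn.
      apply/nonincreasing_seqP => n; rewrite addSn /E big_nat_recr//=.
      by have := se (n + N)%N (leq_addl _ _); lra.
    exists (- K) => _ [n _ <-]; rewrite /E.
    by have := s0 (n + N)%N; have := eK (n + N)%N; lra.
  by exists l; rewrite -(cvg_shiftn N).
have -> : s = (fun n => (s n - E n) + E n).
  by apply/funext => n; rewrite subrK.
exact: is_cvgD.
Qed.

Lemma bounded_partial_sums (f : nat -> \bar R) :
  (forall n, (1 <= n)%N -> (0 <= f n)%E) ->
  (\sum_(1 <= n <oo) f n < +oo)%E ->
  (forall n, (1 <= n)%N -> f n \is a fin_num) /\
  exists K, forall n, \sum_(1 <= k < n.+1) fine (f k) <= K.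
Proof.
move=> f0 foo.
have part n : (\sum_(1 <= k < n.+1) f k <= \sum_(1 <= n <oo) f n)%E.
  by apply: nneseries_lim_ge => k k1 _; exact: f0.
have ffin n : (1 <= n)%N -> f n \is a fin_num.
  move=> n1; rewrite ge0_fin_numE ?f0//; apply: le_lt_trans foo.
  apply: le_trans (part n); rewrite big_nat_recr//= leeDr//.
  by rewrite big_nat_cond sume_ge0// => k /andP[/andP[k1 _] _]; exact: f0.
split=> //; exists (fine (\sum_(1 <= n <oo) f n)%E) => n.
rewrite -lee_fin fineK; last first.
  by rewrite ge0_fin_numE//; apply: nneseries_ge0 => k k1 _; exact: f0.
rewrite -sumEFin; apply: le_trans (part n).
rewrite le_eqVlt; apply/orP; left; apply/eqP.
by apply: eq_big_nat => k /andP[k1 _]; rewrite fineK ?ffin.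
Qed.

Lemma partial_sums_cvgy lambda :
  (forall n, (1 <= n)%N -> 0 < lambda n) -> ~ in_ell 1 lambda ->
  \sum_(1 <= k < n.+1) lambda k @[n --> \oo] --> +oo.
Proof.
move=> lam0 nell; apply/cvgryPge => A; apply: contrapT => nA; apply: nell.
have tau_le n : \sum_(1 <= k < n.+1) lambda k <= A.
  rewrite leNgt; apply/negP => An; apply: nA; exists n => // m /= nm.
  apply/ltW/(lt_le_trans An); rewrite [leRHS](big_cat_nat (n := n.+1))//= lerDl.
  rewrite big_nat_cond sumr_ge0// => k /andP[/andP[k1 _] _].
  by rewrite ltW// lam0// (leq_trans _ k1).
rewrite /in_ell; apply: (@le_lt_trans _ _ A%:E); last exact: ltry.
apply: lime_le.
  by apply: is_cvg_nneseries => n _ _; rewrite lee_fin exprn_ge0.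
exists 1%N => // -[//|n] _ /=.
rewrite sumEFin lee_fin; apply: le_trans (tau_le n).
rewrite le_eqVlt; apply/orP; left; apply/eqP.
apply: eq_big_nat => k /andP[k1 _].
by rewrite expr1 gtr0_norm ?lam0.
Qed.

Lemma square_summable_le lambda (c : R) : 0 < c ->
  (forall n, (1 <= n)%N -> 0 < lambda n) -> in_ell 2 lambda ->
  exists N, forall n, (N <= n)%N -> lambda n.+1 <= c.
Proof.
move=> c0 lam0 ell2.
have [_ [K lamK]] := bounded_partial_sums (fun n => (`|lambda n| ^+ 2)%:E)
  (fun n _ => exprn_ge0 2 (normr_ge0 (lambda n))) ell2.
have sq0 (n : nat) : (1 <= n)%N -> 0 <= `|lambda n| ^+ 2.
  by move=> _; rewrite exprn_ge0.
have cL := bounded_nneg_sum_is_cvg _ K sq0 lamK.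
have /cvgr_lt : `|lambda n.+1| ^+ 2 @[n --> \oo] --> (0 : R).
  have -> : (fun n => `|lambda n.+1| ^+ 2) = (fun n =>
      \sum_(1 <= k < n.+2) `|lambda k| ^+ 2 - \sum_(1 <= k < n.+1) `|lambda k| ^+ 2).
    by apply/funext => n; rewrite [X in X - _]big_nat_recr//= [RHS]addrC addKr.
  have /cvg_ex[l cl] := cL; rewrite -[X in _ --> X](subrr l); apply: cvgB => //.
  by move: cl; rewrite -cvg_shiftS.
move=> /(_ _ (exprn_gt0 2 c0))[N _ NL]; exists N => n /NL /=.
rewrite ltr_sqr ?nnegrE ?(ltW c0)// => /ltW.
exact: le_trans (ler_norm _).
Qed.

End RealSequences.

(** * The ergodic Opial lemma *)

Section Ergodic.
Context {R : realType} {H : completeNormedModType R}.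
Variable dot : {dot H for idfun}.
Hypothesis dot_norm : induces_norm dot.

Local Notation dotE := (dotE dot).
Local Notation dotC := (dotC dot).

Lemma dot_weighted_sum (lambda : nat -> R) (x : nat -> H) h n :
  dot (\sum_(1 <= k < n) lambda k *: x k) h =
  \sum_(1 <= k < n) lambda k * dot (x k) h.
Proof.
rewrite (big_morph (dot^~ h) (fun a b => dotDl dot a b h) (dot0l dot h)).
by apply: eq_bigr => k _; rewrite dotZl.
Qed.

(** Passty's argument.  Weak cluster points of [z] exist because [x], hence its
    means [z], is bounded.  Two of them, [l] and [l'], coincide: [<x_n, l - l'>]
    is an affine combination of [|x_n - l|^2] and [|x_n - l'|^2], so it
    converges, and so does its weighted mean [<z_n, l - l'>]; computing that limit
    along both ultrafilters gives [<l, l - l'> = <l', l - l'>]. *)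
Lemma ergodic_opial (lambda : nat -> R) (x z : nat -> H) (F : set H) :
  (forall n, (1 <= n)%N -> 0 < lambda n) ->
  \sum_(1 <= k < n.+1) lambda k @[n --> \oo] --> +oo ->
  (forall n, (1 <= n)%N -> z n =
    (\sum_(1 <= k < n.+1) lambda k)^-1 *: \sum_(1 <= k < n.+1) lambda k *: x k) ->
  F !=set0 ->
  (forall u, F u -> cvgn (fun n => dot (x n - u) (x n - u))) ->
  (forall U l, UltraFilter U -> \oo `<=` U ->
    (forall h, dot (z n) h @[n --> U] --> dot l h) -> F l) ->
  exists2 l, F l & weakly_cvg dot z l.
Proof.
move=> lam0 tauoo zE [u0 Fu0] Fcvg Fclus.
have means h (l : R) : dot (x n) h @[n --> \oo] --> l ->
    dot (z n) h @[n --> \oo] --> l.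
  move=> xl; apply: cvg_trans (cvg_weighted_mean _ _ _ lam0 tauoo xl).
  apply: near_eq_cvg; near=> n.
  have n1 : (1 <= n)%N by near: n; exists 1%N.
  by rewrite zE// dotZl dot_weighted_sum.
have [K xK] : exists K, forall n, `|x n| <= K.
  have /cvg_seq_bounded/pinfty_ex_gt0[K K0 xK] := Fcvg _ Fu0.
  exists (`|u0| + (1 + K)) => n.
  have := xK n I; rewrite /= ger0_norm ?dotxx_ge0// -(sqr_norm dot)// => xuK.
  have : `|x n - u0| <= 1 + K.
    rewrite -(@ler_sqr _ _ _) ?nnegrE ?addr_ge0 ?(ltW K0)//.
    by apply: le_trans xuK _; nra.
  move=> h; rewrite -(subrK u0 (x n)) addrC.
  by apply: le_trans (ler_normD _ _) _; rewrite lerD2l.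
have zK : \forall n \near \oo, `|z n| <= K.
  have tau_gt := (cvgryPgt _).1 tauoo.
  near=> n; have n1 : (1 <= n)%N by near: n; exists 1%N.
  have tau0 : 0 < \sum_(1 <= k < n.+1) lambda k by near: n; exact: tau_gt.
  rewrite zE// normrZ gtr0_norm ?invr_gt0// mulrC ler_pdivrMr// mulr_sumr.
  apply: le_trans (ler_norm_sum _ _ _) _.
  apply: ler_sum_nat => k /andP[k1 _].
  by rewrite normrZ gtr0_norm ?lam0// mulrC ler_pM2r ?lam0.
have clus U : UltraFilter U -> \oo `<=` U ->
    exists l, forall h, dot (z n) h @[n --> U] --> dot l h.
  by move=> UU ooU; apply: (bounded_ultra_weak_cvg _ _ _ _ K) => //; exact: ooU.
have [U [UU ooU]] := @ultraFilterLemma nat \oo _.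
have [l zl] := clus U UU ooU.
have Fl := Fclus U l UU ooU zl.
exists l => // h; apply: cvg_of_ultra => U' UU' ooU'.
have [l' zl'] := clus U' UU' ooU'.
have Fl' := Fclus U' l' UU' ooU' zl'.
suff -> : l = l' by [].
have [m zm] : exists m : R, dot (z n) (l - l') @[n --> \oo] --> m.
  have /cvg_ex[c cl] := Fcvg _ Fl; have /cvg_ex[c' cl'] := Fcvg _ Fl'.
  exists ((c' - c + (dot l l - dot l' l')) / 2); apply: means.
  have -> : (fun n => dot (x n) (l - l')) = (fun n =>
     (dot (x n - l') (x n - l') - dot (x n - l) (x n - l)
      + (dot l l - dot l' l')) / 2).
    apply/funext => n; rewrite !dotE (dotC l (x n)) (dotC l' (x n)); lra.
  by apply: cvgMr_tmp; apply: cvgD; [exact: cvgB|exact: cvg_cst].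
have lm : dot l (l - l') = m.
  apply: (@norm_cvg_unique _ _ _ _ _ _ (zl _)).
  by move=> S Sm; apply: ooU; exact: zm.
have lm' : dot l' (l - l') = m.
  apply: (@norm_cvg_unique _ _ _ _ _ _ (zl' _)).
  by move=> S Sm; apply: ooU'; exact: zm.
apply/eqP; rewrite -subr_eq0; apply/eqP; apply: (dotxx_eq0 dot).
by rewrite dotDl dotNl lm lm' subrr.
Unshelve. all: by end_near. Qed.

End Ergodic.

(** * One step of the algorithm *)

Section Step.
Context {R : realType} {H : completeNormedModType R}.
Variable dot : {dot H for idfun}.
Implicit Types (B : H -> set H) (C : set H).

Local Notation dotE := (dotE dot).
Local Notation dotC := (dotC dot).

(** Normality of [q] at [u] says that [u] maximises [<q, .>] over [C]. *)
Lemma support_fun_normal_cone C (q u : H) :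
  normal_cone dot C u q -> support_fun dot C q = (dot q u)%:E.
Proof.
move=> [Cu qu]; apply/eqP; rewrite eq_le; apply/andP; split.
  apply: ge_ereal_sup => _ [y Cy <-]; rewrite lee_fin -subr_le0.
  by have := qu _ Cy; rewrite dotDr dotNr.
by apply: ereal_sup_ubound; exists u.
Qed.

Lemma normal_coneZ C (t : R) (p u : H) : 0 <= t ->
  normal_cone dot C u p -> normal_cone dot C u (t *: p).
Proof.
move=> t0 [Cu pu]; split=> // y /pu pyu.
by rewrite dotZl mulr_ge0_le0.
Qed.

Lemma fitzpatrick_gap_ge B C (q u y v : H) : normal_cone dot C u q -> B y v ->
  ((dot u v + dot y q - dot y v - dot u q)%:E <=
   ereal_sup [set fitzpatrick dot B u q | u in C] - support_fun dot C q)%E.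
Proof.
move=> Nq Byv; rewrite (support_fun_normal_cone _ _ _ Nq) EFinB (dotC u q).
rewrite leeD2r//; have [Cu _] := Nq.
apply: (@le_trans _ _ (fitzpatrick dot B u q)).
  by apply: ereal_sup_ubound; exists (y, v).
by apply: ereal_sup_ubound; exists u.
Qed.

(** The graph point [(u, 0)] of [B] already makes the Fitzpatrick function at
    [(u, q)] reach [<u, q>], the value of the support function. *)
Lemma fitzpatrick_gap_ge0 B (q u : H) : normal_cone dot (zer B) u q ->
  (0 <= ereal_sup [set fitzpatrick dot B u q | u in zer B]
        - support_fun dot (zer B) q)%E.
Proof.
move=> Nq; have [Bu _] := Nq.
apply: le_trans (fitzpatrick_gap_ge _ _ _ _ _ _ Nq Bu).
by rewrite !dotE add0r subr0 subrr.
Qed.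

(** Here [x], [w], [x'] stand for [x_(n-1)], [w_n], [x_n], and [dx], [du] for
    [D x], [D u].  With [X], [W], [N] the differences with [u], the
    last two hypotheses bound [<W, X - W>] and [<N, W - N>], which the
    three-point identity rewrites as differences of squared norms; the cross
    terms [lam <X - W, dx - du>] and [lam <N - W, a + du>] are absorbed by
    [|X - W|^2] and [|N - W|^2]. *)
Lemma forward_backward_penalty_step (eta lam e : R) (x w x' u a p dx du : H) :
  0 <= lam <= 2 * eta ->
  eta * dot (dx - du) (dx - du) <= dot (x - u) (dx - du) ->
  0 <= dot (w - u) (x - lam *: dx - w - lam *: a) ->
  lam * dot (x' - u) p - e <= dot (x' - u) (w - x') ->
  dot (x' - u) (x' - u) + 2 * (lam * dot (x' - u) (a + du + p)) <=
  dot (x - u) (x - u) + (2 * e + lam ^+ 2 * dot (a + du) (a + du)).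
Proof.
move=> /andP[lam0 lameta] coco.
have -> : x - lam *: dx - w - lam *: a =
    (x - u) - (w - u) - lam *: ((dx - du) + (a + du)).
  have -> : dx - du + (a + du) = dx + a by rewrite [a + du]addrC addrA subrK.
  have -> : (x - u) - (w - u) = x - w by rewrite opprB addrA subrK.
  by rewrite scalerDr opprD addrA [x - w - _]addrAC.
have -> : w - x' = (w - u) - (x' - u) by rewrite opprB addrA subrK.
move: coco; move: (x - u) (w - u) (x' - u) (dx - du) (a + du) => X W N d c coco.
have := dotxx_ge0 dot (N - W - lam *: c).
have := dotxx_ge0 dot (X - W - lam *: d).
have := ler_wpM2l lam0 coco.
have : 0 <= lam * (2 * eta - lam) * dot d d.
  by rewrite mulr_ge0 ?dotxx_ge0// mulr_ge0// subr_ge0.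
rewrite !dotE (dotC W X) (dotC W N) (dotC d X) (dotC d W) (dotC c N) (dotC c W).
by lra.
Qed.

End Step.

(** * The convergence theorem *)

Theorem theorem1 (R : realType) (H : completeNormedModType R)
    (dot : {dot H for idfun}) (dot_norm : induces_norm dot)
    (A B : H -> set H) (D : H -> H) (eta : R) (C : set H)
    (lambda beta : nat -> R) (x w y z : nat -> H) (tau : nat -> R) :
  maximally_monotone dot A ->
  maximally_monotone dot B ->
  0 < eta ->
  cocoercive dot eta D ->
  C = zer B ->
  C !=set0 ->
  (forall n, (1 <= n)%N -> 0 < lambda n) ->
  (forall n, (1 <= n)%N -> 0 < beta n) ->
  maximally_monotone dot (op_add A (normal_cone dot C)) ->
  zer (op_add (op_add A (op_of_fun D)) (normal_cone dot C)) !=set0 ->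
  (forall p, ran (normal_cone dot C) p ->
    (\sum_(1 <= n <oo) (lambda n * beta n)%:E *
       (ereal_sup [set fitzpatrick dot B u ((beta n)^-1 *: p) | u in C]
        - support_fun dot C ((beta n)^-1 *: p)) < +oo)%E) ->
  in_ell 2 lambda ->
  ~ in_ell 1 lambda ->
  (forall n, (1 <= n)%N -> y n.-1 = x n.-1 - lambda n *: D (x n.-1)) ->
  (forall n, (1 <= n)%N -> resolvent (op_scale (lambda n) A) (y n.-1) (w n)) ->
  (forall n, (1 <= n)%N ->
    resolvent (op_scale (lambda n * beta n) B) (w n) (x n)) ->
  (forall n, (1 <= n)%N -> tau n = \sum_(1 <= k < n.+1) lambda k) ->
  (forall n, (1 <= n)%N ->
    z n = (tau n)^-1 *: \sum_(1 <= k < n.+1) lambda k *: x k) ->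
  exists2 l : H, zer (op_add (op_add A (op_of_fun D)) (normal_cone dot C)) l
               & weakly_cvg dot z l.
Proof.
move=> [Amono _] _ eta0 Dco CB _ lam0 beta0 ANmax zer0 gap_sum ell2 ell1.
move=> yE wE xE tauE zE.
pose S := zer (op_add (op_add A (op_of_fun D)) (normal_cone dot C)).
have tauoo := partial_sums_cvgy _ lam0 ell1.
have tau_gt0 n : (1 <= n)%N -> 0 < tau n.
  move=> n1; rewrite tauE// big_nat_recr//= ltr_wpDl ?lam0//.
  rewrite big_nat_cond sumr_ge0// => k /andP[/andP[k1 _] _].
  by rewrite ltW ?lam0.
have [_ [L lam2L]] := bounded_partial_sums (fun n => (`|lambda n| ^+ 2)%:E)
  (fun n _ => exprn_ge0 2 (normr_ge0 (lambda n))) ell2.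
have [N lamN] := square_summable_le _ _ (mulr_gt0 (ltr0Sn R 1) eta0) lam0 ell2.
(* The descent inequality along every element [a + D u + p] of [T u], with
   summable errors. *)
have descent u a p : A u a -> normal_cone dot C u p ->
  exists e K, [/\ forall n, (1 <= n)%N -> 0 <= e n,
    forall n, \sum_(1 <= k < n.+1) e k <= K &
    forall n, (N <= n)%N -> dot (x n.+1 - u) (x n.+1 - u)
      + 2 * (lambda n.+1 * dot (x n.+1 - u) (a + D u + p))
      <= dot (x n - u) (x n - u) + e n.+1].
  move=> Aua Nup.
  have Nq n : (1 <= n)%N -> normal_cone dot C u ((beta n)^-1 *: p).
    by move=> n1; apply: normal_coneZ Nup; rewrite invr_ge0 ltW ?beta0.
  pose f n := ((lambda n * beta n)%:E *
       (ereal_sup [set fitzpatrick dot B u ((beta n)^-1 *: p) | u in C]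
        - support_fun dot C ((beta n)^-1 *: p)))%E.
  have lb0 n : (1 <= n)%N -> 0 < lambda n * beta n.
    by move=> n1; rewrite mulr_gt0 ?lam0 ?beta0.
  have f0 n : (1 <= n)%N -> (0 <= f n)%E.
    move=> n1; rewrite mule_ge0 ?lee_fin ?(ltW (lb0 _ n1))//.
    by rewrite CB; apply: (fitzpatrick_gap_ge0 _ _ _ u); rewrite -CB; exact: Nq.
  have [ffin [G fG]] :=
    bounded_partial_sums f f0 (gap_sum p (ex_intro2 _ _ u I Nup)).
  pose c := dot (a + D u) (a + D u).
  have c0 : 0 <= c by exact: dotxx_ge0.
  exists (fun n => 2 * fine (f n) + lambda n ^+ 2 * c), (2 * G + L * c); split.
  - move=> n n1; apply: addr_ge0; apply: mulr_ge0; rewrite ?sqr_ge0//.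
    exact/fine_ge0/f0.
  - move=> n; rewrite big_split/= -mulr_sumr -mulr_suml lerD ?ler_pM2l//.
    rewrite ler_wpM2r//; apply: le_trans (lam2L n).
    by apply: ler_sum => k _ /=; rewrite real_normK ?num_real.
  - move=> n Nn; have lam1 := lam0 n.+1 isT; have beta1 := beta0 n.+1 isT.
    apply: (@forward_backward_penalty_step _ _ _ eta _ _ (x n) (w n.+1)
      _ _ _ _ (D (x n))).
    + by rewrite (ltW lam1) lamN.
    + by rewrite -(sqr_norm dot).
    + have [_ -> [_ [a' Aw <-]]] := wE n.+1 isT.
      have -> : y n.+1.-1 = x n - lambda n.+1 *: D (x n) by rewrite yE.
      move=> <-; rewrite [w _ + _ *: _]addrC addrK -scalerBr dotZr.
      by rewrite mulr_ge0 ?(ltW lam1)//; exact: Amono Aw Aua.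
    (* [(w - x) / (lambda beta)] belongs to [B x]: test the Fitzpatrick
       function with it. *)
    + have [_ -> [_ [v Bxv <-]]] := xE n.+1 isT.
      move=> <-; rewrite [x _ + _ *: _]addrC addrK dotZr.
      have := fitzpatrick_gap_ge dot B C _ _ _ _ (Nq n.+1 isT) Bxv.
      rewrite -(@lee_pmul2l _ (lambda n.+1 * beta n.+1)%:E) ?lte_fin ?lb0//.
      rewrite -/(f n.+1) -EFinM -(fineK (ffin n.+1 isT)) lee_fin.
      rewrite !dotE => h.
      have lbK : lambda n.+1 * beta n.+1 * (beta n.+1)^-1 = lambda n.+1.
        by rewrite mulfK// gt_eqF.
      rewrite -{1}lbK; move: h; lra.
have S_descent u : S u -> exists e K, [/\ forall n, (1 <= n)%N -> 0 <= e n,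
    forall n, \sum_(1 <= k < n.+1) e k <= K &
    forall n, (N <= n)%N ->
      dot (x n.+1 - u) (x n.+1 - u) <= dot (x n - u) (x n - u) + e n.+1].
  move=> [_ [a Aua [_ -> <-]]] [p Nup apD0].
  have [e [K [e0 eK xe]]] := descent u a p Aua Nup.
  exists e, K; split=> // n Nn.
  by have := xe n Nn; rewrite apD0 dot0r !mulr0 addr0.
apply: (ergodic_opial dot dot_norm lambda x z S lam0 tauoo).
- by move=> n n1; rewrite zE// tauE.
- exact: zer0.
- move=> u /S_descent[e [K [e0 eK xe]]].
  by apply: (quasi_fejer_is_cvg _ e K N) => // n; exact: dotxx_ge0.
- move=> U l UU ooU zl.
  (* [A + N_C] is maximal, so it suffices to test [- D l] against its graph. *)
  suff [a Al [p Np apD]] : op_add A (normal_cone dot C) l (- D l).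
    exists (a + D l); first by exists a => //; exists (D l).
    by exists p => //; rewrite addrAC apD addNr.
  apply: (add_cocoercive_unextendable dot dot_norm _ _ eta) => //.
  move=> u _ [a Au [p Np <-]].
  have [e [K [e0 eK xe]]] := descent u a p Au Np.
  have [K' TK] := sum_decrements_bounded
    (fun n => dot (x n - u) (x n - u))
    (fun n => 2 * (lambda n * dot (x n - u) (a + D u + p))) e K N
    (fun n => dotxx_ge0 dot _) eK xe.
  have -> : a + p + D u = a + D u + p by rewrite addrAC.
  set v := a + D u + p in TK *.
  have zv : \forall n \near U, dot (z n) v - dot u v <= (tau n)^-1 * (K' / 2).
    apply: ooU; exists (maxn N 1) => // n /=; rewrite geq_max => /andP[Nn n1].
    have tau0 := tau_gt0 n n1.
    rewrite -(ler_pM2l tau0) mulrA divff ?gt_eqF// mul1r mulrBr.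
    have -> : tau n * dot (z n) v = \sum_(1 <= k < n.+1) lambda k * dot (x k) v.
      rewrite zE// dotZl mulrA divff ?gt_eqF// mul1r.
      exact: dot_weighted_sum.
    rewrite [in X in _ - X]tauE// mulr_suml -sumrB.
    have := TK n Nn; rewrite -mulr_sumr mulrC -ler_pdivlMr//.
    by under eq_bigr do rewrite dotDl dotNl mulrBr.
  have taul : (tau n)^-1 * (K' / 2) @[n --> U] --> 0.
    have : (tau n)^-1 * (K' / 2) @[n --> \oo] --> 0 * (K' / 2).
      apply: cvgMr_tmp; apply/gtr0_cvgV0.
        by exists 1%N => // n n1; exact: tau_gt0.
      apply: cvg_trans tauoo; apply: near_eq_cvg.
      by exists 1%N => // n n1; rewrite tauE.
    by rewrite mul0r; apply: cvg_trans => X XU; exact: ooU.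
  have : dot l v - dot u v <= 0.
    exact: ler_cvg_to (cvgB (zl v) (cvg_cst (dot u v))) taul zv.
  by rewrite dotDl dotNl -subr_ge0 sub0r opprB.
Qed.
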